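(* Given two nondeterministic Büchi automata $\mathcal{A}$, $\mathcal{B}$ with $n_a$ and $n_b$ states, respectively, and statistical parameters $\varepsilon$ and $\delta$, let $M = \lceil \ln\delta/\ln(1-\varepsilon)\rceil$ and $n = \max(n_a,n_b)$. Then the algorithm $\mathsf{IMC}^2$ (run on $(\mathcal{A},\mathcal{B},K,p_\bot,\varepsilon,\delta)$) runs in time $O(M\cdot K\cdot n^2)$ and space $O(K\cdot n^2)$.
   Context: A nondeterministic Büchi automaton (NBA) is $(\Sigma, Q, Q_I, T, Q_F)$ with finite alphabet $\Sigma$, finite state set $Q$, non-empty set $Q_I \subseteq Q$ of initial states, transitions $T \subseteq Q\times\Sigma\times Q$, accepting states $Q_F \subseteq Q$. It accepts an $\omega$-word if some run on it starting in $Q_I$ visits $Q_F$ infinitely often; $\mathcal{L}(\cdot)$ is the set of accepted $\omega$-words. Let $\mathcal{A} = (\Sigma, Q, Q_I, T, Q_F)$; it is assumed that every state of $\mathcal{A}$ can reach an accepting state and has at least one outgoing transition. $K\ge 2$ is a natural number, $p_\bot\in(0,1)$ is a stopping probability, $\varepsilon$ (error probability) and $\delta$ (significance level) are in $(0,1)$. A finite run $\sigma = q_0 a_0 q_1 \cdots q_m a_m q_{m+1}$ of $\mathcal{A}$ (so $q_0\in Q_I$, $(q_j,a_j,q_{j+1})\in T$) is a $K$-lasso if each state in $\{q_0,\dots,q_m\}$ occurs at most $K-1$ times in $q_0 a_0 \cdots a_{m-1} q_m$, and $q_{m+1} = q_i$ for some $0 \le i \le m$; the associated $\omega$-word is $uv^\omega$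 with $(u,v) = (a_0\cdots a_{i-1}, a_i\cdots a_m)$. A terminating $K$-lasso is sampled by a random walk on the transition graph of $\mathcal{A}$: start in a uniformly chosen initial state; at a state visited for the first time, take a uniformly chosen outgoing transition; at a state whose number of visits so far is at least $2$ and less than $K$, stop with probability $p_\bot$, and otherwise (probability $1-p_\bot$) take a uniformly chosen outgoing transition; at a state visited for the $K$-th time, stop. Algorithm $\mathsf{IMC}^2(\mathcal{A},\mathcal{B},K,p_\bot,\varepsilon,\delta)$: compute $M = \lceil \ln\delta/\ln(1-\varepsilon)\rceil$; for each of $M$ iterations: sample a terminating $K$-lasso of $\mathcal{A}$, with associated pair $(u,v)$; test whether $uv^\omega\in\mathcal{L}(\mathcal{A})$, and if so test whether $uv^\omega\in\mathcal{L}(\mathcal{B})$; if $uv^\omega \in\mathcal{L}(\mathcal{A})$ and $uv^\omega\notin\mathcal{L}(\mathcal{B})$, return $(\mathit{false},(u,v))$. If the loop ends, return $\mathit{true}$. (It is a known fact that membership of $uv^\omega$ in the language of an NBA with $k$ states is decidable in time and space linear in $k\cdot(|u|+|v|)$; this is the membership test used.) *)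

(* Defs.v *)
From mathcomp Require Import all_boot all_order all_algebra.
From mathcomp Require Import reals exp.

Set Implicit Arguments.
Unset Strict Implicit.
Unset Printing Implicit Defensive.

Import Order.TTheory GRing.Theory Num.Theory.

Record nba (Sigma Q : finType) := NBA {
  nba_init : {set Q};
  nba_trans : {set Q * Sigma * Q};
  nba_final : {set Q};
  nba_init_neq0 : nba_init != set0 }.

Definition accepts (Sigma Q : finType) (N : nba Sigma Q) (w : nat -> Sigma) :=
  exists r : nat -> Q,
    [/\ r 0 \in nba_init N,
        forall k, (r k, w k, r k.+1) \in nba_trans N
      & forall k, exists2 j, k <= j & r j \in nba_final N].

Definition nba_edge (Sigma Q : finType) (N : nba Sigma Q) : rel Q :=
  [rel q q' | [exists a, (q, a, q') \in nba_trans N]].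

Definition live (Sigma Q : finType) (N : nba Sigma Q) :=
  forall q : Q,
    (exists2 f, f \in nba_final N & connect (nba_edge N) q f)
    /\ (exists q', nba_edge N q q').

(* The word u v^omega, for v nonempty; [a0] is only a default for [nth]. *)
Definition lasso_word (Sigma : finType) (a0 : Sigma) (u v : seq Sigma) :
    nat -> Sigma :=
  fun k => if k < size u then nth a0 u k
           else nth a0 v ((k - size u) %% size v).

(* A decision procedure for [u v^omega \in L(N)], called by the machine below as
   a subroutine: its answer, running time and working space on each input. *)

Record lasso_test := LassoTest {
  lt_answer : forall Sigma Q : finType,
    nba Sigma Q -> seq Sigma -> seq Sigma -> bool;
  lt_time : forall Sigma Q : finType,
    nba Sigma Q -> seq Sigma -> seq Sigma -> nat;
  lt_space : forall Sigma Q : finType,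
    nba Sigma Q -> seq Sigma -> seq Sigma -> nat }.

Definition correct_test (mt : lasso_test) :=
  forall (Sigma Q : finType) (N : nba Sigma Q) (u : seq Sigma) (a : Sigma)
         (v : seq Sigma),
    lt_answer mt N u (a :: v) <-> accepts N (lasso_word a u (a :: v)).

Definition linear_test (mt : lasso_test) :=
  exists c : nat,
    forall (Sigma Q : finType) (N : nba Sigma Q) (u v : seq Sigma),
      v != [::] ->
      lt_time mt N u v <= c * (#|Q| * (size u + size v)) /\
      lt_space mt N u v <= c * (#|Q| * (size u + size v)).

(* Expressions and commands of a probabilistic random-access machine.  The
   memory consists of segments of cells; a cell holds one natural number, and
   segment 0 contains the scalar variables.  States and letters are represented
   by their ranks.  The two input automata are read-only and are not part of the
   memory; the queries [NumStates], ..., [Target] look up the adjacency lists of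
   the first one.  An instruction costs one unit of time for itself and one for
   each node of its expressions, plus the time of the membership test if it
   calls it. *)

Inductive expr :=
  | Num of nat
  | Cell of nat & expr          (* Cell a e: cell number e of segment a *)
  | Add of expr & expr
  | Eq of expr & expr           (* comparisons return 0 or 1 *)
  | Lt of expr & expr
  | NumStates
  | NumInit
  | Init of expr                (* Init j: j-th initial state *)
  | OutDeg of expr              (* number of transitions leaving a state *)
  | Label of expr & expr        (* Label q j: letter of j-th transition from q *)
  | Target of expr & expr.      (* Target q j: its target *)

Inductive side := SideA | SideB.

Inductive cmd (R : realType) :=
  | Skip
  | Store of nat & expr & expr  (* Store a e1 e2: segment a at e1 := e2 *)
  | Seq of cmd R & cmd R
  | If of expr & cmd R & cmd R
  | While of expr & cmd R
  | Unif of nat & expr          (* Unif x e: x := uniform in {0, ..., e - 1} *)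
  | Flip of nat & R             (* Flip x p: x := 1 with probability p, else 0 *)
  | Any of nat                  (* Any x: x := 0 or 1, left unspecified *)
  | Test of side & nat & expr & expr
      (* Test s x i l: x := does automaton s accept u v^omega, where u is the
         interval [0, i) and v the interval [i, l) of the word segment *)
  | RetTrue
  | RetFalse of expr & expr.    (* return (false, (u, v)), with u, v as above *)

Arguments Skip {R}.
Arguments Store {R}.
Arguments Unif {R}.
Arguments Any {R}.
Arguments Test {R}.
Arguments RetTrue {R}.
Arguments RetFalse {R}.

Definition memory := seq (seq nat).

Definition segment (mem : memory) (a : nat) : seq nat := nth [::] mem a.

Definition store (mem : memory) (a i w : nat) : memory :=
  set_nth [::] mem a (set_nth 0 (segment mem a) i w).

(* One word for each segment and one for each of its cells.  A segment extends
   up to the largest address at which it has been written. *)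
Definition mem_size (mem : memory) : nat := size mem + sumn (shape mem).

Definition seg_word : nat := 1.

Section Machine.

Variables (R : realType) (mt : lasso_test) (Sigma QA QB : finType).
Variables (A : nba Sigma QA) (B : nba Sigma QB).

Definition rank (T : finType) (x : T) : nat := enum_rank x.

Definition out_edges (q : nat) : seq (Sigma * QA) :=
  if onth (enum QA) q is Some s
  then enum [set x : Sigma * QA | (s, x.1, x.2) \in nba_trans A] else [::].

Fixpoint eval (mem : memory) (e : expr) : nat :=
  match e with
  | Num k => k
  | Cell a e1 => nth 0 (segment mem a) (eval mem e1)
  | Add e1 e2 => eval mem e1 + eval mem e2
  | Eq e1 e2 => (eval mem e1 == eval mem e2)
  | Lt e1 e2 => (eval mem e1 < eval mem e2)
  | NumStates => #|QA|
  | NumInit => #|nba_init A|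
  | Init e1 =>
      if onth (enum (nba_init A)) (eval mem e1) is Some q then rank q else 0
  | OutDeg e1 => size (out_edges (eval mem e1))
  | Label e1 e2 =>
      if onth (out_edges (eval mem e1)) (eval mem e2) is Some (a, _)
      then rank a else 0
  | Target e1 e2 =>
      if onth (out_edges (eval mem e1)) (eval mem e2) is Some (_, q)
      then rank q else 0
  end.

Definition lasso_at (mem : memory) (i l : nat) : seq Sigma * seq Sigma :=
  let letters := pmap (onth (enum Sigma)) in
  let w := segment mem seg_word in
  (letters (take i w), letters (drop i (take l w))).

Definition run_test T (f : forall Q : finType,
    nba Sigma Q -> seq Sigma -> seq Sigma -> T)
    (s : side) (uv : seq Sigma * seq Sigma) : T :=
  match s with
  | SideA => f _ A uv.1 uv.2
  | SideB => f _ B uv.1 uv.2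
  end.

(* The list of commands is what remains to be executed.  The result [None]
   stands for "true" and [Some (u, v)] for "(false, (u, v))". *)
Inductive config :=
  | Run of seq (cmd R) & memory
  | Halt of memory & option (seq Sigma * seq Sigma).

(* [step c p c']: c moves to c' with probability p.  The two outcomes of [Any]
   are nondeterministic alternatives, not random ones. *)
Inductive step : config -> R -> config -> Prop :=
  | StepSkip k mem : step (Run (Skip :: k) mem) 1 (Run k mem)
  | StepStore a e1 e2 k mem :
      step (Run (Store a e1 e2 :: k) mem) 1
           (Run k (store mem a (eval mem e1) (eval mem e2)))
  | StepSeq c1 c2 k mem :
      step (Run (Seq c1 c2 :: k) mem) 1 (Run (c1 :: c2 :: k) mem)
  | StepIf e c1 c2 k mem :
      step (Run (If e c1 c2 :: k) mem) 1
           (Run ((if eval mem e != 0 then c1 else c2) :: k) mem)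
  | StepWhile e c k mem :
      step (Run (While e c :: k) mem) 1
           (Run (if eval mem e != 0 then c :: While e c :: k else k) mem)
  | StepUnif x e k mem v :
      v < eval mem e ->
      step (Run (Unif x e :: k) mem) ((eval mem e)%:R^-1)%R
           (Run k (store mem 0 x v))
  | StepFlip1 x p k mem :
      step (Run (Flip x p :: k) mem) p (Run k (store mem 0 x 1))
  | StepFlip0 x p k mem :
      step (Run (Flip x p :: k) mem) (1 - p)%R (Run k (store mem 0 x 0))
  | StepAny x (b : bool) k mem :
      step (Run (Any x :: k) mem) 1 (Run k (store mem 0 x b))
  | StepTest s x i l k mem :
      step (Run (Test s x i l :: k) mem) 1
           (Run k (store mem 0 x (run_test (@lt_answer mt Sigma) s
                                   (lasso_at mem (eval mem i) (eval mem l)))))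
  | StepRetTrue k mem :
      step (Run (RetTrue :: k) mem) 1 (Halt mem None)
  | StepRetFalse i l k mem :
      step (Run (RetFalse i l :: k) mem) 1
           (Halt mem (Some (lasso_at mem (eval mem i) (eval mem l)))).

Fixpoint expr_cost (e : expr) : nat :=
  match e with
  | Num _ | NumStates | NumInit => 1
  | Cell _ e1 | Init e1 | OutDeg e1 => (expr_cost e1).+1
  | Add e1 e2 | Eq e1 e2 | Lt e1 e2 | Label e1 e2 | Target e1 e2 =>
      (expr_cost e1 + expr_cost e2).+1
  end.

Definition step_time (c : config) : nat :=
  match c with
  | Run (Store _ e1 e2 :: _) _ => (expr_cost e1 + expr_cost e2).+1
  | Run ((If e _ _ | While e _ | Unif _ e) :: _) _ => (expr_cost e).+1
  | Run (Test s _ i l :: _) mem =>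
      (expr_cost i + expr_cost l).+1
      + run_test (@lt_time mt Sigma) s
          (lasso_at mem (eval mem i) (eval mem l))
  | Run (RetFalse i l :: _) _ => (expr_cost i + expr_cost l).+1
  | Run _ _ => 1
  | Halt _ _ => 0
  end.

Definition config_space (c : config) : nat :=
  match c with
  | Run (Test s _ i l :: _) mem =>
      mem_size mem
      + run_test (@lt_space mt Sigma) s
          (lasso_at mem (eval mem i) (eval mem l))
  | Run _ mem | Halt mem _ => mem_size mem
  end.

(* [reaches c t c']: an execution of positive probability leads from c to c' in
   time t. *)
Inductive reaches : config -> nat -> config -> Prop :=
  | Reaches0 c : reaches c 0 c
  | ReachesS c p c' t c'' :
      step c p c' -> (0 < p)%R -> reaches c' t c'' ->
      reaches c (step_time c + t) c''.

Definition halted (c : config) : Prop := if c is Halt _ _ then True else False.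

Definition start (P : cmd R) : config := Run [:: P] [::].

(* As every step takes time at least 1, the bound on partial executions excludes
   infinite ones, and the last clause excludes stuck ones: hence all executions
   halt, within time T. *)
Definition runs_in_time (P : cmd R) (T : nat) : Prop :=
  forall t c, reaches (start P) t c ->
    t <= T /\ (halted c \/ exists p c', step c p c' /\ (0 < p)%R).

Definition runs_in_space (P : cmd R) (S : nat) : Prop :=
  forall t c, reaches (start P) t c -> config_space c <= S.

End Machine.

Definition num_samples (R : realType) (eps delta : R) : nat :=
  `|Num.ceil (ln delta / ln (1 - eps))%R|%N.

Definition seg_run : nat := 2.    (* seg_run[k] is the state q_k *)
Definition seg_visits : nat := 3. (* number of visits to each state *)

Definition v_iter : nat := 0.
Definition v_max : nat := 1.      (* the number M of iterations *)
Definition v_len : nat := 2.      (* number of transitions taken so far *)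
Definition v_cur : nat := 3.
Definition v_stop : nat := 4.
Definition v_i : nat := 5.        (* start of the loop of the lasso *)
Definition v_j : nat := 6.
Definition v_b : nat := 7.

Definition get (x : nat) : expr := Cell 0 (Num x).

Section Algorithm.

Variable R : realType.

Local Notation "c1 ;; c2" := (Seq c1 c2)
  (at level 60, right associativity).
Local Notation cmd := (cmd R).

Definition set_var (x : nat) (e : expr) : cmd := Store 0 (Num x) e.

Definition incr (x : nat) : cmd := set_var x (Add (get x) (Num 1)).

Definition visit_current : cmd :=
  Store seg_visits (get v_cur) (Add (Cell seg_visits (get v_cur)) (Num 1)).

Definition reset_visits : cmd :=
  set_var v_j (Num 0) ;;
  While (Lt (get v_j) NumStates)
    (Store seg_visits (get v_j) (Num 0) ;; incr v_j).

(* The walk q_0 a_0 q_1 ... q_m a_m q_{m+1}: on exit, v_len = m + 1 and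
   v_cur = q_{m+1}. *)
Definition random_walk (K : nat) (p_stop : R) : cmd :=
  reset_visits ;;
  set_var v_len (Num 0) ;;
  Unif v_j NumInit ;;
  set_var v_cur (Init (get v_j)) ;;
  visit_current ;;
  set_var v_stop (Num 0) ;;
  While (Eq (get v_stop) (Num 0))
    (If (Lt (Cell seg_visits (get v_cur)) (Num 2)) Skip
       (If (Lt (Cell seg_visits (get v_cur)) (Num K))
          (Flip v_stop p_stop)
          (set_var v_stop (Num 1))) ;;
     If (Eq (get v_stop) (Num 0))
       (Unif v_j (OutDeg (get v_cur)) ;;
        Store seg_run (get v_len) (get v_cur) ;;
        Store seg_word (get v_len) (Label (get v_cur) (get v_j)) ;;
        incr v_len ;;
        set_var v_cur (Target (get v_cur) (get v_j)) ;;
        visit_current)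
       Skip).

(* Choose some i <= m with q_i = q_{m+1}.  For K > 2 there may be several such
   i; which one is taken is left open. *)
Definition close_lasso : cmd :=
  set_var v_i (Num 0) ;;
  While (Eq (Eq (Cell seg_run (get v_i)) (get v_cur)) (Num 0)) (incr v_i) ;;
  set_var v_j (Add (get v_i) (Num 1)) ;;
  While (Lt (get v_j) (get v_len))
    (If (Eq (Cell seg_run (get v_j)) (get v_cur))
       (Any v_b ;;
        If (get v_b) (set_var v_i (get v_j)) Skip)
       Skip ;;
     incr v_j).

Definition check_lasso : cmd :=
  Test SideA v_b (get v_i) (get v_len) ;;
  If (get v_b)
    (Test SideB v_b (get v_i) (get v_len) ;;
     If (get v_b) Skip (RetFalse (get v_i) (get v_len)))
    Skip.

Definition imc2 (K : nat) (p_stop eps delta : R) : cmd :=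
  set_var v_max (Num (num_samples eps delta)) ;;
  set_var v_iter (Num 0) ;;
  While (Lt (get v_iter) (get v_max))
    (random_walk K p_stop ;;
     close_lasso ;;
     check_lasso ;;
     incr v_iter) ;;
  RetTrue.

End Algorithm.

(* Main.v *)
(* The bounds hold for every execution, so probabilities play no role and a
   Hoare logic with a time budget suffices.  The only nonlocal fact is the length
   of the sampled run: the walk leaves a state only if it has visited it fewer
   than [K] times, so it takes at most [n * K] transitions, where [n] is the
   number of states of [A].  Sampling and closing the lasso thus cost [O(n * K)],
   each of the two membership tests costs [O(n * (n * K))], and there are [M]
   iterations. *)

Require Import Defs.
From mathcomp Require Import all_boot all_order all_algebra.
From mathcomp Require Import reals exp zify.
Set Implicit Arguments.
Unset Strict Implicit.
Unset Printing Implicit Defensive.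

Import Order.TTheory GRing.Theory Num.Theory.

Local Arguments segment : simpl never.
Local Arguments store : simpl never.

(** * Counting occurrences, and positivity of the number of samples *)

Lemma sum_count_mem n (s : seq nat) :
  all (gtn n) s -> \sum_(q < n) count_mem (val q) s = size s.
Proof.
elim: s => [|x s IHs] /=; first by rewrite big1.
case/andP=> lt_xn lt_sn; rewrite big_split /= (IHs lt_sn).
rewrite (bigD1 (Ordinal lt_xn)) //= eqxx big1 // => q.
by rewrite -val_eqE eq_sym /= => /negbTE->.
Qed.

(** Pigeonhole principle. Applied to the states that the walk has left, it bounds the length of the
    walk. *)
Lemma size_count_mem_le n K (s : seq nat) :
    all (gtn n) s -> (forall q, q < n -> count_mem q s <= K) ->
  size s <= n * K.
Proof.
move=> lt_sn le_sK; rewrite -(sum_count_mem lt_sn) -[n in n * K]card_ord -sum_nat_const.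
by apply: leq_sum => q _; exact: le_sK (ltn_ord q).
Qed.

Lemma onth_some T (s : seq T) i : i < size s -> exists x, onth s i = Some x.
Proof. by elim: s i => [|x s IHs] [|i] //=; [exists x | apply: IHs]. Qed.

Lemma rank_lt (T : finType) (x : T) : rank x < #|T|.
Proof. exact: ltn_ord. Qed.

(** Both logarithms are negative, so their quotient is positive. With at least one iteration, the
    constant cost outside the loop can be absorbed into a multiple of [M]. *)
Lemma num_samples_gt0 (R : realType) (eps delta : R) :
  (0 < eps < 1)%R -> (0 < delta < 1)%R -> 0 < num_samples eps delta.
Proof.
move=> /andP[eps_gt0 eps_lt1] delta01; rewrite /num_samples absz_gt0.
suff: (0 < Num.ceil (ln delta / ln (1 - eps)))%R by move/lt0r_neq0.
rewrite ceil_gt0 -mulrNN -invrN divr_gt0 // oppr_gt0 ln_lt0 //.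
by rewrite subr_gt0 eps_lt1 /= ltrBlDr ltrDl.
Qed.

(** * Reading and writing memory cells *)

Definition rd (mem : memory) a i := nth 0 (segment mem a) i.

Lemma rd_store mem a i w b j :
  rd (store mem a i w) b j = if (b == a) && (j == i) then w else rd mem b j.
Proof.
rewrite /rd /store /segment nth_set_nth /=.
by case: (b =P a) => [->|//]; rewrite nth_set_nth /=.
Qed.

Lemma size_segment_store mem a i w b :
  size (segment (store mem a i w) b) =
  if b == a then maxn i.+1 (size (segment mem a)) else size (segment mem b).
Proof.
rewrite /store /segment nth_set_nth /=.
by case: (b =P a) => // _; rewrite size_set_nth.
Qed.

(** * A Hoare logic with a time budget and a space cap *)

Section Logic.

Variables (R : realType) (mt : lasso_test) (Sigma QA QB : finType).
Variables (A : nba Sigma QA) (B : nba Sigma QB) (S : nat).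

(** Time, progress and space are bundled, so that a single derivation yields both halves of the
    result. Time is consumed and hence a parameter; space is reused, so its cap [S] is fixed for the
    whole section. *)
Definition safe (T : nat) (c : config R Sigma) : Prop :=
  forall t c', reaches mt A B c t c' ->
    [/\ t <= T,
        halted c' \/ exists p c'', step mt A B c' p c'' /\ (0 < p)%R
      & config_space mt A B c' <= S].

(* Time is a resource: [Q] receives the part of the budget [T] that [c] has
   left unspent.  The bound [T' <= T] is what lets [wp_while] proceed by
   induction on the budget. *)
Definition wp (c : cmd R) (Q : nat -> memory -> Prop) (T : nat)
    (mem : memory) : Prop :=
  forall k,
    (forall T' mem', T' <= T -> Q T' mem' -> safe T' (Run Sigma k mem')) ->
    safe T (Run Sigma (c :: k) mem).

(** Unfolds the first step of an execution; each command rule below reduces to it by inverting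
    [step]. *)
Lemma safe_step T c :
    config_space mt A B c <= S -> step_time mt A B c <= T ->
    (exists p c', step mt A B c p c' /\ (0 < p)%R) ->
    (forall p c', step mt A B c p c' -> (0 < p)%R ->
       safe (T - step_time mt A B c) c') ->
  safe T c.
Proof.
move=> cS cT ex_step safe_next t c' reach_c'.
case: reach_c' cS cT ex_step safe_next => {c t c'}
  [c|c p c1 t c2 c_c1 p_gt0 reach_c2] cS cT ex_step safe_next.
  by split; [|right|].
have [tT ? ?] := safe_next _ _ c_c1 p_gt0 _ _ reach_c2.
by split=> //; lia.
Qed.

Lemma safe_halt T mem r : mem_size mem <= S -> safe T (Halt R mem r).
Proof.
move=> memS t c' reach_c'; inversion reach_c' as [|? ? ? ? ? st]; subst.
  by split=> //; left.
by inversion st.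
Qed.

Lemma wp_skip Q T mem :
  mem_size mem <= S -> 0 < T -> Q (T - 1) mem -> wp Skip Q T mem.
Proof.
move=> memS TT HQ k kQ; apply: safe_step => //=.
  by exists 1%R; eexists; split; [exact: StepSkip | exact: ltr01].
by move=> p c' st _; inversion st; subst; apply: kQ => //=; lia.
Qed.

Lemma wp_store Q a e1 e2 T mem :
    mem_size mem <= S -> (expr_cost e1 + expr_cost e2).+1 <= T ->
    Q (T - (expr_cost e1 + expr_cost e2).+1)
      (store mem a (eval A mem e1) (eval A mem e2)) ->
  wp (Store a e1 e2) Q T mem.
Proof.
move=> memS TT HQ k kQ; apply: safe_step => //.
  by exists 1%R; eexists; split; [exact: StepStore | exact: ltr01].
by move=> p c' st _; inversion st; subst; apply: kQ => //=; lia.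
Qed.

Lemma wp_seq Q c1 c2 T mem :
    mem_size mem <= S -> 0 < T -> wp c1 (wp c2 Q) (T - 1) mem ->
  wp (Seq c1 c2) Q T mem.
Proof.
move=> memS TT HQ k kQ; apply: safe_step => //=.
  by exists 1%R; eexists; split; [exact: StepSeq | exact: ltr01].
move=> p c' st _; inversion st; subst; apply: HQ => T1 mem1 le_T1 wp2.
by apply: wp2 => T2 mem2 le_T2; apply: kQ; lia.
Qed.

Lemma wp_if Q e c1 c2 T mem :
    mem_size mem <= S -> (expr_cost e).+1 <= T ->
    wp (if eval A mem e != 0 then c1 else c2) Q (T - (expr_cost e).+1) mem ->
  wp (If e c1 c2) Q T mem.
Proof.
move=> memS TT HQ k kQ; apply: safe_step => //.
  by exists 1%R; eexists; split; [exact: StepIf | exact: ltr01].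
by move=> p c' st _; inversion st; subst; apply: HQ => T' mem' ?; apply: kQ; lia.
Qed.

(** The guard costs at least one unit, so the body starts with a strictly smaller budget, and
    induction on the budget replaces a separate variant. The invariant itself must ensure that the
    budget suffices for the remaining rounds. *)
Lemma wp_while (Inv Q : nat -> memory -> Prop) e c T mem :
    (forall T mem, Inv T mem ->
       [/\ mem_size mem <= S, (expr_cost e).+1 <= T
         & if eval A mem e != 0 then wp c Inv (T - (expr_cost e).+1) mem
           else Q (T - (expr_cost e).+1) mem]) ->
  Inv T mem -> wp (While e c) Q T mem.
Proof.
move=> Inv_step; elim/ltn_ind: T mem => T IHT mem /Inv_step[memS TT HQ] k kQ.
apply: safe_step => //.
  by exists 1%R; eexists; split; [exact: StepWhile | exact: ltr01].
move=> p c' st _; inversion st; subst; case: ifP HQ => _ HQ.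
  apply: HQ => T1 mem1 le_T1 /IHT; apply; first by rewrite /= in le_T1; lia.
  by move=> T2 mem2 ?; apply: kQ; lia.
by apply: kQ => //=; lia.
Qed.

Lemma wp_unif Q x e T mem :
    mem_size mem <= S -> 0 < eval A mem e -> (expr_cost e).+1 <= T ->
    (forall v, v < eval A mem e ->
       Q (T - (expr_cost e).+1) (store mem 0 x v)) ->
  wp (Unif x e) Q T mem.
Proof.
move=> memS e_gt0 TT HQ k kQ; apply: safe_step => //.
  exists ((eval A mem e)%:R^-1)%R; eexists.
  by split; [exact: StepUnif e_gt0 | rewrite invr_gt0 ltr0n].
move=> p c' st _; inversion st; subst; apply: kQ; last exact: HQ.
by rewrite /=; lia.
Qed.

Lemma wp_flip Q x (p : R) T mem :
    mem_size mem <= S -> (0 < p < 1)%R -> 0 < T ->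
    (forall b : bool, Q (T - 1) (store mem 0 x b)) ->
  wp (Flip x p) Q T mem.
Proof.
move=> memS /andP[p_gt0 p_lt1] TT HQ k kQ; apply: safe_step => //.
  by exists p; eexists; split; [exact: StepFlip1 | ].
move=> p' c' st _; inversion st; subst; apply: kQ => /=; try lia.
  exact: HQ true.
exact: HQ false.
Qed.

Lemma wp_any Q x T mem :
    mem_size mem <= S -> 0 < T ->
    (forall b : bool, Q (T - 1) (store mem 0 x b)) ->
  wp (Any x) Q T mem.
Proof.
move=> memS TT HQ k kQ; apply: safe_step => //.
  by exists 1%R; eexists; split; [exact: (StepAny _ _ _ _ true) | exact: ltr01].
move=> p c' st _; inversion st; subst; apply: kQ; first by rewrite /=; lia.
exact: HQ.
Qed.

(** The actual running time of the subroutine is replaced by a bound [W], so the postcondition is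
    required for every budget at least what [W] would leave. The answer is treated as an arbitrary
    bit. *)
Lemma wp_test Q s x i l W T mem :
    let uv := lasso_at Sigma mem (eval A mem i) (eval A mem l) in
    let cost := (expr_cost i + expr_cost l).+1 in
    run_test A B (@lt_time mt Sigma) s uv <= W ->
    mem_size mem + run_test A B (@lt_space mt Sigma) s uv <= S ->
    cost + W <= T ->
    (forall T' (b : bool), T - (cost + W) <= T' -> Q T' (store mem 0 x b)) ->
  wp (Test s x i l) Q T mem.
Proof.
move=> uv cost timeW spaceS TT HQ k kQ; apply: safe_step.
- by [].
- by rewrite /= -/uv -/cost; lia.
- by exists 1%R; eexists; split; [exact: StepTest | exact: ltr01].
move=> p c' st _; inversion st; subst; apply: kQ.
  by rewrite /=; lia.
by apply: HQ; rewrite /= -/uv -/cost; lia.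
Qed.

(** A return discards the pending commands, so any postcondition holds, even a false one. *)
Lemma wp_ret_true Q T mem : mem_size mem <= S -> 0 < T -> wp RetTrue Q T mem.
Proof.
move=> memS TT k kQ; apply: safe_step => //.
  by exists 1%R; eexists; split; [exact: StepRetTrue | exact: ltr01].
by move=> p c' st _; inversion st; subst; apply: safe_halt.
Qed.

Lemma wp_ret_false Q i l T mem :
    mem_size mem <= S -> (expr_cost i + expr_cost l).+1 <= T ->
  wp (RetFalse i l) Q T mem.
Proof.
move=> memS TT k kQ; apply: safe_step => //.
  by exists 1%R; eexists; split; [exact: StepRetFalse | exact: ltr01].
by move=> p c' st _; inversion st; subst; apply: safe_halt.
Qed.

End Logic.

(** * Capacities of the memory segments *)

Section Invariant.

Variables (Sigma : finType) (n L : nat).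

(** The segments hold the eight scalars, the word, the run and the visit counters; [L] stands for
    the bound on the number of transitions of the walk. *)
Definition sized (mem : memory) :=
  [/\ size mem <= 4, size (segment mem 0) <= 8,
      size (segment mem 1) <= L, size (segment mem 2) <= L
    & size (segment mem 3) <= n].

Definition well_formed (mem : memory) :=
  sized mem /\ all (gtn #|Sigma|) (segment mem 1).

(** A write to the word segment overwrites a cell or appends one directly after the last. No padding
    arises, so each cell remains the rank of a letter. *)
Definition writable (mem : memory) (a i w : nat) : bool :=
  match a with
  | 0 => i < 8
  | 1 => [&& i < L, i <= size (segment mem 1) & w < #|Sigma|]
  | 2 => i < L
  | 3 => i < n
  | _ => false
  end.

Lemma mem_size_le mem : sized mem -> mem_size mem <= 12 + L + L + n.
Proof.
rewrite /mem_size; case: mem => [|s0 [|s1 [|s2 [|s3 [|? ?]]]]] [];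
  rewrite /segment /= => *; lia.
Qed.

Lemma well_formed_store mem a i w :
  writable mem a i w -> well_formed mem -> well_formed (store mem a i w).
Proof.
move=> ok [[s s0 s1 s2 s3] lt_s1].
have s' : size (store mem a i w) <= 4.
  by rewrite /store size_set_nth; move: ok; case: a => [|[|[|[|a]]]] //=; lia.
split; first by split=> //; rewrite size_segment_store;
  case: a ok {s'} => [|[|[|[|a]]]] //= ok; lia.
apply/(all_nthP 0) => j lt_j; rewrite -/(rd _ _ _) rd_store.
move: lt_j; rewrite size_segment_store.
case: (1 =P a) => [<-|_] in ok * => /=; last by move=> lt_j; apply: (all_nthP 0 lt_s1).
case/and3P: ok => _ le_i lt_w.
case: (j =P i) => [//|neq_ji lt_j]; apply: (all_nthP 0 lt_s1).
lia.
Qed.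

End Invariant.

(** * Cost of the phases of the algorithm: common invariant and resetting the counters *)

Section Imc2.

Variables (R : realType) (mt : lasso_test) (Sigma QA QB : finType).
Variables (A : nba Sigma QA) (B : nba Sigma QB) (n K S W M : nat).
Variable p_stop : R.
Hypothesis card_QA : #|QA| = n.
Hypothesis A_live : live A.
Hypothesis K_ge2 : 2 <= K.
Hypothesis p_stop01 : (0 < p_stop < 1)%R.

Local Notation L := (n * K).
Local Notation wp := (@wp R mt Sigma QA QB A B S).
Local Notation eval := (eval A).

Hypothesis test_bound : forall s mem i l,
  well_formed Sigma n L mem -> i < l <= size (segment mem 1) ->
  let uv := lasso_at Sigma mem i l in
  run_test A B (@lt_time mt Sigma) s uv <= W /\
  run_test A B (@lt_space mt Sigma) s uv <= W.
Hypothesis S_ge : 12 + L + L + n + W <= S.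

Definition at_iter (it : nat) (mem : memory) :=
  [/\ well_formed Sigma n L mem, rd mem 0 v_max = M & rd mem 0 v_iter = it].

(** Describes a store by its effect on reads and sizes, so that successive memories can stay
    abstract instead of growing into nested [set_nth] terms. *)
Definition written (mem : memory) (a i w : nat) (mem' : memory) :=
  (forall b j, rd mem' b j = if (b == a) && (j == i) then w else rd mem b j)
  /\ (forall b, size (segment mem' b) =
        if b == a then maxn i.+1 (size (segment mem a))
        else size (segment mem b)).

Lemma at_iter_mem_size it mem : at_iter it mem -> mem_size mem <= S.
Proof. by case=> -[/mem_size_le memS _] _ _; lia. Qed.

(** Scalars 0 and 1 hold the iteration counter and [M]; a write to segment 0 must avoid just these
    two. *)
Lemma at_iter_store it mem a i w :
    writable Sigma n L mem a i w -> (a == 0) ==> (1 < i) -> at_iter it mem ->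
  at_iter it (store mem a i w) /\ written mem a i w (store mem a i w).
Proof.
move=> ok i_gt1 [wf_mem max_mem it_mem]; split; last first.
  by split=> *; rewrite ?rd_store ?size_segment_store.
split; first exact: well_formed_store.
  by rewrite rd_store; case: a i_gt1 {ok} => [|a] //=; case: eqP => // <-.
by rewrite rd_store; case: a i_gt1 {ok} => [|a] //=; case: eqP => // <-.
Qed.

Lemma wp_write Q it a e1 e2 T mem :
    at_iter it mem -> (expr_cost e1 + expr_cost e2).+1 <= T ->
    writable Sigma n L mem a (eval mem e1) (eval mem e2) ->
    (a == 0) ==> (1 < eval mem e1) ->
    (forall mem', at_iter it mem' ->
       written mem a (eval mem e1) (eval mem e2) mem' ->
       Q (T - (expr_cost e1 + expr_cost e2).+1) mem') ->
  wp (Store a e1 e2) Q T mem.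
Proof.
move=> it_mem TT ok i_gt1 HQ; apply: wp_store => //.
  exact: at_iter_mem_size it_mem.
by have [] := at_iter_store ok i_gt1 it_mem; apply: HQ.
Qed.

Local Ltac pre :=
  try solve [by apply: at_iter_mem_size; eassumption | by rewrite //=; lia].
Local Ltac vars := rewrite /v_iter /v_max /v_len /v_cur /v_stop /v_i /v_j /v_b
  /seg_word /seg_run /seg_visits /=.
Local Ltac evals := vars; rewrite -?/(rd _ _ _).

(** Here and in the later phases, [T0] is the budget promised to whatever follows, and the numerical
    constants are generous bounds on instruction costs. *)
Lemma wp_reset_visits Q it T T0 mem :
    at_iter it mem -> 30 * n + 20 + T0 <= T ->
    (forall T' mem', T0 <= T' -> at_iter it mem' ->
       (forall q, q < n -> rd mem' 3 q = 0) -> Q T' mem') ->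
  wp (reset_visits R) Q T mem.
Proof.
move=> it_mem TT HQ; rewrite /reset_visits /set_var /incr.
apply: wp_seq; pre; apply: (wp_write it_mem); pre => mem1 it_mem1 [E1 _].
(* One round of the loop costs less than 30; the 10 pays for the last evaluation of the guard. *)
pose Inv T mem := at_iter it mem /\ exists j,
  [/\ rd mem 0 6 = j, j <= n, forall q, q < j -> rd mem 3 q = 0
    & 30 * (n - j) + 10 + T0 <= T].
apply: (@wp_while _ _ _ _ _ _ _ _ Inv); last first.
  split=> //; exists 0; split=> //.
  by rewrite /=; lia.
move=> {it_mem TT mem1 it_mem1 E1} {}T {}mem [it_mem [j [Ej le_jn visits0 TT]]].
split; pre; evals; rewrite Ej card_QA; case: ltnP => /= [lt_jn|le_nj]; last first.
  by apply: HQ => //; [lia | move=> q lt_q; apply: visits0; lia].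
apply: wp_seq; pre; apply: (wp_write it_mem); pre; evals; rewrite ?Ej //.
move=> mem1 it_mem1 [E1 _].
apply: (wp_write it_mem1); pre; evals; rewrite ?E1 ?Ej /=.
move=> mem2 it_mem2 [E2 _]; split=> //; exists j.+1; split=> //; pre.
- by rewrite E2 /= addn1.
- move=> q; rewrite ltnS E2 /= E1 /=; case: (q =P j) => // neq_qj le_qj.
  by apply: visits0; lia.
Qed.

(** * The random walk: ranges of its choices, its invariant and its length *)

Lemma size_out_edges_gt0 q : q < n -> 0 < size (out_edges A q).
Proof.
rewrite -card_QA /out_edges => lt_q.
have [|x ->] := @onth_some _ (enum QA) q; first by rewrite -cardE.
(* Liveness provides an outgoing transition, so the uniform choice of one never gets stuck. *)
have [_ [y /existsP[a xay]]] := A_live x.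
by rewrite -cardE; apply/card_gt0P; exists (a, y); rewrite inE.
Qed.

Lemma eval_label_lt mem e1 e2 :
    eval mem e2 < size (out_edges A (eval mem e1)) ->
  eval mem (Label e1 e2) < #|Sigma|.
Proof. by move=> /onth_some[[a q] /= ->]; apply: rank_lt. Qed.

Lemma eval_target_lt mem e1 e2 :
    eval mem e2 < size (out_edges A (eval mem e1)) ->
  eval mem (Target e1 e2) < n.
Proof. by rewrite -card_QA => /onth_some[[a q] /= ->]; apply: rank_lt. Qed.

Lemma eval_init_lt mem e : eval mem e < #|nba_init A| -> eval mem (Init e) < n.
Proof.
by rewrite -card_QA cardE => /onth_some[q /= ->]; apply: rank_lt.
Qed.

(* [s] is the sequence q_0 ... q_(m-1) of states that have been left, and [cur]
   is q_m. *)
Definition walking it (s : seq nat) cur mem :=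
  [/\ at_iter it mem, rd mem 0 2 = size s, rd mem 0 3 = cur, cur < n
    & all (gtn n) s] /\
  [/\ forall k, k < size s -> rd mem 2 k = nth 0 s k,
      forall q, q < n -> count_mem q s < K,
      forall q, q < n -> rd mem 3 q = (q == cur) + count_mem q s
    & size s <= size (segment mem 1)].

(** The invariant mentions only the scalars 0 to 3: counter, [M], length and current state. *)
Lemma walking_written it s cur mem i w mem' :
    walking it s cur mem -> at_iter it mem' -> written mem 0 i w mem' ->
    3 < i -> walking it s cur mem'.
Proof.
move=> [[it_mem len cur_mem lt_cur lt_s] [run few visits word]] it_mem' [E sz].
case: i E sz => [|[|[|[|i]]]] // E sz _.
by split; split; rewrite ?E ?sz // => q; rewrite E //=; [apply: run | apply: visits].
Qed.

(** The visit counter of [cur] is one more than its count in [s]. If the walk goes on, leaving [cur]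
    keeps its count below [K]; if it stops, [cur] occurs in [s], so the lasso can be closed. *)
Lemma wp_stop_test Q it s cur T mem :
    walking it s cur mem -> rd mem 0 4 = 0 -> 20 <= T ->
    (forall T' mem', T - 20 <= T' -> walking it s cur mem' ->
       (rd mem' 0 4 = 0 /\ (count_mem cur s).+1 < K) \/
       (rd mem' 0 4 = 1 /\ 0 < count_mem cur s) -> Q T' mem') ->
  wp (If (Lt (Cell seg_visits (get v_cur)) (Defs.Num 2)) Skip
       (If (Lt (Cell seg_visits (get v_cur)) (Defs.Num K))
          (Flip v_stop p_stop)
          (set_var R v_stop (Defs.Num 1)))) Q T mem.
Proof.
move=> walk_mem stop0 TT HQ.
have [[it_mem len cur_mem lt_cur lt_s] [run few visits word]] := walk_mem.
apply: wp_if; pre; evals; rewrite cur_mem visits // eqxx add1n.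
case: ltnP => /= [lt2|ge2].
  by apply: wp_skip; pre; apply: HQ => //; [lia | left; split=> //; exact: leq_trans lt2 K_ge2].
apply: wp_if; pre; evals; rewrite cur_mem visits // eqxx add1n.
case: ltnP => /= [ltK|geK].
  apply: wp_flip; pre => // b.
  have [it_mem' wr_mem'] := @at_iter_store it mem 0 4 b isT isT it_mem.
  apply: HQ; first by lia.
    exact: walking_written walk_mem it_mem' wr_mem' _.
  by rewrite rd_store; case: b {it_mem' wr_mem'}; [right | left].
apply: (wp_write it_mem); pre => // mem' it_mem' wr_mem'.
apply: HQ; first by rewrite /=; lia.
  exact: walking_written walk_mem it_mem' wr_mem' _.
by right; split; [rewrite wr_mem'.1 | exact: leq_trans K_ge2 geK].
Qed.

Lemma wp_take_step Q it s cur T mem :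
    walking it s cur mem -> rd mem 0 4 = 0 -> (count_mem cur s).+1 < K ->
    60 <= T ->
    (forall T' mem' cur', T - 60 <= T' ->
       walking it (rcons s cur) cur' mem' -> rd mem' 0 4 = 0 -> size s < L ->
       Q T' mem') ->
  wp (Seq (Unif v_j (OutDeg (get v_cur)))
     (Seq (Store seg_run (get v_len) (get v_cur))
     (Seq (Store seg_word (get v_len) (Label (get v_cur) (get v_j)))
     (Seq (incr R v_len)
     (Seq (set_var R v_cur (Target (get v_cur) (get v_j)))
          (visit_current R)))))) Q T mem.
Proof.
move=> [[it_mem len cur_mem lt_cur lt_s] [run few visits word]] stop0 cntK TT HQ.
have few' q : q < n -> count_mem q (rcons s cur) < K.
  move=> lt_q; rewrite -cats1 count_cat /= addn0.
  by case: (cur =P q) => [<-|_]; rewrite ?addn1 // addn0 few.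
have lt_s' : all (gtn n) (rcons s cur) by rewrite all_rcons /= lt_cur.
(* Counting also the state about to be left makes the bound strict. Hence address [size s] is within
   capacity, and the variant [L - size s] of the walk decreases. *)
have lt_size : size s < L.
  by rewrite -(size_rcons s cur); apply: size_count_mem_le => // q /few' /ltnW.
apply: wp_seq; pre; apply: wp_unif; pre.
  by evals; rewrite cur_mem size_out_edges_gt0.
evals; rewrite cur_mem => v lt_v.
have [it_mem1 [E1 Z1]] := @at_iter_store it mem 0 6 v isT isT it_mem.
move: (store mem 0 6 v) it_mem1 E1 Z1 => mem1 it_mem1 E1 Z1.
apply: wp_seq; pre; apply: (wp_write it_mem1); pre; evals;
  rewrite ?E1 /= ?len ?cur_mem //.
move=> mem2 it_mem2 [E2 Z2].
apply: wp_seq; pre; apply: (wp_write it_mem2); pre.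
  have len2 : eval mem2 (get v_len) = size s.
    by rewrite /= -/(rd _ _ _) E2 /= E1 /= len.
  apply/and3P; split; rewrite ?len2 //; first by rewrite Z2 /= Z1 /=.
  apply: eval_label_lt; evals; rewrite !E2 /= !E1 /= cur_mem.
  exact: lt_v.
move=> mem3 it_mem3; evals; rewrite !E2 /= !E1 /= len cur_mem => -[E3 Z3].
apply: wp_seq; pre; apply: (wp_write it_mem3); pre => // mem4 it_mem4.
evals; rewrite E3 /= E2 /= E1 /= len addn1 => -[E4 Z4].
apply: wp_seq; pre; apply: (wp_write it_mem4); pre => // mem5 it_mem5.
pose cur' := eval mem4 (Target (get v_cur) (get v_j)).
have lt_cur' : cur' < n.
  apply: eval_target_lt; evals; rewrite !E4 /= !E3 /= !E2 /= !E1 /= cur_mem.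
  exact: lt_v.
rewrite -/cur' => -[E5 Z5].
have cur5 : eval mem5 (get v_cur) = cur' by rewrite /= -/(rd _ _ _) E5.
apply: (wp_write it_mem5); pre; rewrite ?cur5 // => mem6 it_mem6.
evals; rewrite !E5 /= E4 /= E3 /= E2 /= E1 /= => -[E6 Z6].
apply: (HQ _ _ cur'); last exact: lt_size; pre.
  split; split=> //.
  - by rewrite E6 /= E5 /= E4 /= size_rcons.
  - by rewrite E6 /= E5.
  - move=> k; rewrite size_rcons ltnS nth_rcons E6 /= E5 /= E4 /= E3 /= E2 /= E1 /=.
    case: (ltngtP k (size s)) => // lt_k _; exact: run.
  (* Leaving [cur] moves its contribution from the indicator into the count over [rcons s cur]; the
     new indicator belongs to [cur']. *)
  - move=> q lt_q; rewrite E6 /= E5 /= E4 /= E3 /= E2 /= E1 /=.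
    rewrite -cats1 count_cat /= addn0 addn1.
    case: (q =P cur') => [->|_]; rewrite visits //=.
      by rewrite add1n -addnC eq_sym.
    by rewrite add0n addnC eq_sym.
  - rewrite size_rcons Z6 /= Z5 /= Z4 /= Z3 /=; exact: leq_maxl.
by rewrite E6 /= E5 /= E4 /= E3 /= E2 /= E1 /=.
Qed.

Lemma wp_random_walk Q it T T0 mem :
    at_iter it mem -> 30 * n + 200 * L + 400 + T0 <= T ->
    (forall T' mem' s cur, T0 <= T' -> walking it s cur mem' ->
       0 < count_mem cur s -> Q T' mem') ->
  wp (random_walk K p_stop) Q T mem.
Proof.
move=> it_mem TT HQ; rewrite /random_walk.
apply: wp_seq; pre.
apply: (@wp_reset_visits _ it _ (200 * L + 350 + T0)) => //; first by lia.
move=> {TT mem it_mem} {}T {}mem TT it_mem visits0.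
apply: wp_seq; pre; apply: (wp_write it_mem); pre => // mem1 it_mem1 [E1 Z1].
apply: wp_seq; pre; apply: wp_unif; pre.
  by rewrite /= card_gt0 nba_init_neq0.
move=> v lt_v; have [it_mem2 [E2 Z2]] := @at_iter_store it mem1 0 6 v isT isT it_mem1.
move: (store mem1 0 6 v) it_mem2 E2 Z2 => mem2 it_mem2 E2 Z2.
apply: wp_seq; pre; apply: (wp_write it_mem2); pre => // mem3 it_mem3.
pose cur := eval mem2 (Init (get v_j)).
have lt_cur : cur < n.
  by apply: eval_init_lt; evals; rewrite E2.
rewrite -/cur => -[E3 Z3].
have cur3 : eval mem3 (get v_cur) = cur by rewrite /= -/(rd _ _ _) E3.
apply: wp_seq; pre; apply: (wp_write it_mem3); pre; rewrite ?cur3 //.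
move=> mem4 it_mem4; evals; rewrite !E3 /= E2 /= E1 /= visits0 // => -[E4 Z4].
apply: wp_seq; pre; apply: (wp_write it_mem4); pre => // mem5 it_mem5 [E5 Z5].
have walk5 : walking it [::] cur mem5.
  split; split=> //.
  - by rewrite E5 /= E4 /= E3 /= E2 /= E1.
  - by rewrite E5 /= E4 /= E3 /=.
  - by move=> q _; apply: ltn_trans K_ge2.
  - move=> q lt_q; rewrite E5 /= E4 /= E3 /= E2 /= E1 /=.
    by case: (q =P cur) => //= _; rewrite visits0.
have stop5 : rd mem5 0 4 = 0 by rewrite E5.
(* Each transition is charged 200. The extra 100 pays for the round in which the walk stops without
   moving; after that only one guard evaluation remains. *)
pose Inv T mem := exists s cur, walking it s cur mem /\
  ((rd mem 0 4 = 0 /\ 200 * (L - size s) + 100 + T0 <= T) \/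
   [/\ rd mem 0 4 = 1, 0 < count_mem cur s & 20 + T0 <= T]).
apply: (@wp_while _ _ _ _ _ _ _ _ Inv); last first.
  exists [::], cur; split=> //; left; split=> //.
  by rewrite /= subn0; lia.
clear - HQ K_ge2 p_stop01 A_live card_QA S_ge.
move=> T mem [s [cur [walk_mem TT]]].
have [[it_mem _ _ _ _] _] := walk_mem.
split; pre; first by case: TT => -[*]; rewrite /=; lia.
evals; case: TT => -[stop]; last first.
  by move=> cnt TT; rewrite stop /=; apply: HQ walk_mem cnt; lia.
move=> TT; rewrite stop /=; apply: wp_seq; pre.
apply: (wp_stop_test walk_mem) => //; first by lia.
move=> T' mem' TT' walk_mem' stop'.
have [[it_mem' _ _ _ _] _] := walk_mem'.
apply: wp_if; pre; evals; case: stop' => -[stop' cnt]; rewrite stop' /=; last first.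
  by apply: wp_skip; pre; exists s, cur; split=> //; right; split=> //; lia.
apply: (wp_take_step walk_mem') => //; pre.
move=> T2 mem2 cur2 TT2 walk_mem2 stop2 lt_s.
exists (rcons s cur), cur2; split=> //; left; split=> //.
by rewrite size_rcons; lia.
Qed.

(** * Closing the lasso and testing its word *)

Lemma wp_close_lasso Q it s cur T T0 mem :
    walking it s cur mem -> 0 < count_mem cur s -> 100 * L + 100 + T0 <= T ->
    (forall T' mem' i, T0 <= T' -> at_iter it mem' -> rd mem' 0 2 = size s ->
       rd mem' 0 5 = i -> i < size s <= size (segment mem' 1) -> Q T' mem') ->
  wp (close_lasso R) Q T mem.
Proof.
move=> walk_mem cnt TT HQ; rewrite /close_lasso.
have [[it_mem len cur_mem lt_cur lt_s] [run few visits word]] := walk_mem.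
have le_sL : size s <= L.
  by apply: size_count_mem_le => // q lt_q; apply/ltnW/few.
have s_cur : cur \in s by rewrite -has_pred1 has_count.
have [i0 lt_i0 nth_i0] : exists2 i, i < size s & nth 0 s i = cur.
  by exists (index cur s); rewrite ?index_mem ?nth_index.
apply: wp_seq; pre; apply: (wp_write it_mem); pre => // mem1 it_mem1 wr1.
have walk_mem1 := walking_written walk_mem it_mem1 wr1 isT.
have i_mem1 : rd mem1 0 5 = 0 by rewrite wr1.1.
apply: wp_seq; pre.
(* The search cannot pass [i0], where [cur] is found, so it stays inside the recorded run and
   terminates. *)
pose Inv1 T mem := exists i,
  [/\ walking it s cur mem, rd mem 0 5 = i, i <= i0 &
      20 * (size s - i) + 50 * L + 70 + T0 <= T].
apply: (@wp_while _ _ _ _ _ _ _ _ Inv1); last first.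
  by exists 0; split=> //; rewrite /= subn0; lia.
clear - HQ K_ge2 p_stop01 A_live card_QA S_ge lt_i0 nth_i0 le_sL.
move=> T mem [i [walk_mem i_mem le_i TT]].
have [[it_mem len cur_mem lt_cur lt_s] [run few visits word]] := walk_mem.
have lt_i : i < size s by lia.
split; pre; evals; rewrite i_mem cur_mem run //.
case: (nth 0 s i =P cur) => /= [eq_cur|neq_cur]; last first.
  apply: (wp_write it_mem); pre => // mem1 it_mem1 wr1.
  have walk_mem1 := walking_written walk_mem it_mem1 wr1 isT.
  exists i.+1; split=> //; last by rewrite /=; lia.
    by rewrite wr1.1 /= -/(rd _ _ _) i_mem addn1.
  have : i != i0 by apply: contra_notN neq_cur => /eqP->.
  by lia.
apply: wp_seq; pre; apply: (wp_write it_mem); pre => // mem1 it_mem1 wr1.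
have walk_mem1 := walking_written walk_mem it_mem1 wr1 isT.
have i_mem1 : rd mem1 0 5 = i by rewrite wr1.1.
have j_mem1 : rd mem1 0 6 = i.+1.
  by rewrite wr1.1 /= -/(rd _ _ _) i_mem addn1.
(* Whatever [Any] chooses, [i] is an index already scanned. At the end this gives [i < size s], a
   nonempty loop part as the membership test requires. *)
pose Inv2 T mem := exists i j,
  [/\ walking it s cur mem, rd mem 0 5 = i, rd mem 0 6 = j, i < j <= size s &
      50 * (size s - j) + 20 + T0 <= T].
apply: (@wp_while _ _ _ _ _ _ _ _ Inv2); last first.
  by exists i, i.+1; split=> //; rewrite /=; lia.
clear - HQ K_ge2 p_stop01 A_live card_QA S_ge.
move=> T mem [i [j [walk_mem i_mem j_mem lt_ij TT]]].
have [[it_mem len cur_mem lt_cur lt_s] [run few visits word]] := walk_mem.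
split; pre; evals; rewrite len j_mem.
case: ltnP => /= [lt_j|ge_j]; last first.
  apply: (HQ _ _ i) => //; first by lia.
  by rewrite word andbT; lia.
(* The common end of the three branches: no match, match not taken, and match taken, the last with
   [i'] equal to [j]. *)
have incr_j T' mem' i' : 50 * (size s - j.+1) + 30 + T0 <= T' ->
    walking it s cur mem' -> rd mem' 0 5 = i' -> i' <= j ->
    rd mem' 0 6 = j -> wp (incr R v_j) Inv2 T' mem'.
  move=> TT' walk_mem' i_mem' le_i' j_mem'.
  have [[it_mem' _ _ _ _] _] := walk_mem'.
  apply: (wp_write it_mem'); pre => // mem1 it_mem1 wr1.
  exists i', j.+1; split; rewrite ?wr1.1 //=.
  - exact: walking_written walk_mem' it_mem1 wr1 isT.
  - by rewrite -/(rd _ _ _) j_mem' addn1.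
  - by rewrite ltnS le_i' lt_j.
  - by lia.
apply: wp_seq; pre; apply: wp_if; pre; evals; rewrite j_mem cur_mem run //.
case: (nth 0 s j =P cur) => /= [eq_cur|neq_cur]; last first.
  by apply: wp_skip; pre; apply: (incr_j _ _ i) => //; lia.
apply: wp_seq; pre; apply: wp_any; pre => b.
have [it_mem1 wr1] := @at_iter_store it mem 0 7 b isT isT it_mem.
have walk_mem1 := walking_written walk_mem it_mem1 wr1 isT.
move: (store mem 0 7 b) it_mem1 wr1 walk_mem1 => mem1 it_mem1 wr1 walk_mem1.
have i_mem1 : rd mem1 0 5 = i by rewrite wr1.1.
have j_mem1 : rd mem1 0 6 = j by rewrite wr1.1.
apply: wp_if; pre; evals; case: ifP => _; last first.
  by apply: wp_skip; pre; apply: (incr_j _ _ i) => //; lia.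
apply: (wp_write it_mem1); pre => // mem2 it_mem2 wr2.
apply: (incr_j _ _ j) => //; first by rewrite /=; lia.
- exact: walking_written walk_mem1 it_mem2 wr2 isT.
- by rewrite wr2.1.
- by rewrite wr2.1.
Qed.

Lemma wp_check_lasso Q it T T0 mem i l :
    at_iter it mem -> rd mem 0 2 = l -> rd mem 0 5 = i ->
    i < l <= size (segment mem 1) -> 2 * W + 60 + T0 <= T ->
    (forall T' mem', T0 <= T' -> at_iter it mem' -> Q T' mem') ->
  wp (check_lasso R) Q T mem.
Proof.
move=> it_mem l_mem i_mem lt_il TT HQ; rewrite /check_lasso.
(* Stated for any memory and side, since the two tests run in memories that differ in [v_b]. *)
have tested mem' s : at_iter it mem' -> rd mem' 0 2 = l -> rd mem' 0 5 = i ->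
    i < l <= size (segment mem' 1) ->
    let uv := lasso_at Sigma mem' (eval mem' (get v_i)) (eval mem' (get v_len)) in
    run_test A B (@lt_time mt Sigma) s uv <= W /\
    mem_size mem' + run_test A B (@lt_space mt Sigma) s uv <= S.
  move=> it_mem' l_mem' i_mem' lt_il'; evals; rewrite l_mem' i_mem'.
  have [wf_mem' _ _] := it_mem'.
  have [? ?] := test_bound s wf_mem' lt_il'; split=> //.
  by have := mem_size_le wf_mem'.1; lia.
have [timeA spaceA] := tested mem SideA it_mem l_mem i_mem lt_il.
apply: wp_seq; pre; apply: (wp_test timeA spaceA); first by rewrite /=; lia.
move=> T1 b TT1.
have [it_mem1 wr1] := @at_iter_store it mem 0 7 b isT isT it_mem.
move: (store mem 0 7 b) it_mem1 wr1 => mem1 it_mem1 [E1 Z1].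
have {}TT1 : W + 40 + T0 <= T1 by move: TT1; rewrite /=; lia.
apply: wp_if; pre; case: ifP => _; last first.
  by apply: wp_skip; pre; apply: HQ => //=; lia.
have l_mem1 : rd mem1 0 2 = l by rewrite E1.
have i_mem1 : rd mem1 0 5 = i by rewrite E1.
have lt_il1 : i < l <= size (segment mem1 1) by rewrite Z1.
have [timeB spaceB] := tested mem1 SideB it_mem1 l_mem1 i_mem1 lt_il1.
apply: wp_seq; pre; apply: (wp_test timeB spaceB); first by rewrite /=; lia.
move=> T2 b' TT2.
have [it_mem2 _] := @at_iter_store it mem1 0 7 b' isT isT it_mem1.
move: (store mem1 0 7 b') it_mem2 => mem2 it_mem2.
have {}TT2 : 20 + T0 <= T2 by move: TT2; rewrite /=; lia.
apply: wp_if; pre; case: ifP => _; last by apply: wp_ret_false; pre.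
by apply: wp_skip; pre; apply: HQ => //=; lia.
Qed.

(** * The main loop *)

Lemma wp_imc2 Q eps delta T :
    num_samples eps delta = M ->
    M * (30 * n + 300 * L + 2 * W + 700) + 50 <= T ->
  wp (imc2 K p_stop eps delta) Q T [::].
Proof.
move=> eqM TT; rewrite /imc2 eqM.
apply: wp_seq; [by [] | by lia |]; apply: wp_store; [by [] | by rewrite /=; lia |].
set mem1 := store _ _ _ _; have sz1 : mem_size mem1 <= S.
  (* Writing address 1 of segment 0 creates one segment with two cells. *)
  by have -> : mem_size mem1 = 3 by []; lia.
apply: wp_seq; pre; apply: wp_store; pre.
set mem2 := store _ _ _ _.
have it_mem2 : at_iter 0 mem2 by split.
have sz2 := at_iter_mem_size it_mem2.
apply: wp_seq; pre.
pose Inv T mem := exists it, [/\ at_iter it mem, it <= M &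
  (M - it) * (30 * n + 300 * L + 2 * W + 700) + 20 <= T].
apply: (@wp_while _ _ _ _ _ _ _ _ Inv); last first.
  by exists 0; split=> //; rewrite subn0 /=; lia.
clear TT mem1 mem2 sz1 it_mem2 sz2.
move=> {}T mem [it [it_mem le_it TT]].
have [_ max_mem it_val] := it_mem.
split; pre; evals; rewrite max_mem it_val.
case: ltnP => /= [lt_it|_]; last by apply: wp_ret_true; pre.
(* The budget reserved for the remaining iterations, passed through the phases as part of [T0]. *)
pose Y := (M - it.+1) * (30 * n + 300 * L + 2 * W + 700) + 20.
have {}TT : 30 * n + 300 * L + 2 * W + 700 + Y <= T.
  by rewrite /Y addnA -mulSn -subSn ?subSS.
apply: wp_seq; pre.
apply: (@wp_random_walk _ _ _ (100 * L + 2 * W + 250 + Y) _ it_mem); pre.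
move=> T1 mem1 s cur TT1 walk_mem1 cnt.
have [[it_mem1 _ _ _ _] _] := walk_mem1.
apply: wp_seq; pre.
apply: (@wp_close_lasso _ _ _ _ _ (2 * W + 100 + Y) _ walk_mem1 cnt); pre.
move=> T2 mem2 i TT2 it_mem2 len2 i_mem2 lt_i.
apply: wp_seq; pre.
apply: (@wp_check_lasso _ _ _ (20 + Y) _ _ _ it_mem2 len2 i_mem2 lt_i); pre.
move=> T3 mem3 TT3 it_mem3; have [wf_mem3 max_mem3 it_val3] := it_mem3.
(* This write changes the iteration counter, which [wp_write] would have to preserve. *)
apply: wp_store; pre; evals; rewrite it_val3.
exists it.+1; split=> //; last by rewrite -/Y; lia.
split; first exact: well_formed_store.
  by rewrite rd_store.
by rewrite rd_store /= addn1.
Qed.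

End Imc2.

(** * Size of the decoded lasso and the asymptotic bounds *)

Lemma lasso_at_size (Sigma : finType) mem i l :
    all (gtn #|Sigma|) (segment mem seg_word) ->
    i < l <= size (segment mem seg_word) ->
  let uv := lasso_at Sigma mem i l in
  size uv.1 + size uv.2 <= l /\ uv.2 != [::].
Proof.
rewrite /lasso_at /=; set w := segment mem seg_word => lt_w /andP[lt_il le_l].
have size_letters s : size (pmap (onth (enum Sigma)) s) <= size s.
  by rewrite size_pmap count_size.
split.
  rewrite (leq_trans (leq_add (size_letters _) (size_letters _))) //.
  by rewrite size_drop !size_takel //; lia.
(* Decoding drops cells that are not ranks of letters. Cell [i] is the first of the loop part and is
   such a rank, so the loop part stays nonempty. *)
have [x x_v lt_x] : exists2 x, x \in drop i (take l w) & x < #|Sigma|.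
  have lt_i : i < size w by lia.
  exists (nth 0 w i); last exact: (all_nthP 0 lt_w).
  by rewrite (drop_nth 0) ?size_takel // nth_take // mem_head.
have [a a_x] := @onth_some _ (enum Sigma) x (leq_trans lt_x (eq_leq (cardE _))).
rewrite -size_eq0 size_pmap -lt0n -has_count; apply/hasP; exists x => //=.
by rewrite a_x.
Qed.

Theorem theorem4 (mt : lasso_test)
    (mt_correct : correct_test mt) (mt_linear : linear_test mt) :
  exists C : nat,
  forall (R : realType) (Sigma QA QB : finType)
    (A : nba Sigma QA) (B : nba Sigma QB) (K : nat) (p_stop eps delta : R),
    live A ->
    2 <= K ->
    (0 < p_stop < 1)%R -> (0 < eps < 1)%R -> (0 < delta < 1)%R ->
    let M := num_samples eps delta in
    let n := maxn #|QA| #|QB| in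
    runs_in_time mt A B (imc2 K p_stop eps delta) (C * (M * K * n ^ 2)) /\
    runs_in_space mt A B (imc2 K p_stop eps delta) (C * (K * n ^ 2)).
Proof.
(* The constant depends only on that of the membership test: [2 * c] covers the two tests of an
   iteration, [1100] the machine's own instructions and cells. *)
case: mt_linear => c test_c; exists (1100 + 2 * c).
move=> R Sigma QA QB A B K p_stop eps delta A_live K_ge2 p01 eps01 delta01 M n.
have M_gt0 : 0 < M := num_samples_gt0 eps01 delta01.
pose L := #|QA| * K.
have QA_gt0 : 0 < #|QA|.
  have /set0Pn[q _] := nba_init_neq0 A.
  by apply/card_gt0P; exists q.
(* Bounds a test on either automaton: the number of states is at most [n], while the lasso is a run
   of [A] and has length at most [L]. *)
pose W := c * (n * L).
have test_W s mem i l :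
    well_formed Sigma #|QA| L mem -> i < l <= size (segment mem 1) ->
    let uv := lasso_at Sigma mem i l in
    run_test A B (@lt_time mt Sigma) s uv <= W /\
    run_test A B (@lt_space mt Sigma) s uv <= W.
  move=> [[_ _ le_wL _ _] lt_w] lt_il uv.
  have [size_uv v_neq0] := lasso_at_size lt_w lt_il.
  have size_uvL : size uv.1 + size uv.2 <= L.
    by apply: leq_trans size_uv _; case/andP: lt_il => _ /leq_trans; apply.
  case: s => /=.
    have [le_t le_s] := test_c _ _ A uv.1 uv.2 v_neq0.
    split; [apply: leq_trans le_t _ | apply: leq_trans le_s _];
      by rewrite leq_mul2l leq_mul ?orbT ?leq_maxl.
  have [le_t le_s] := test_c _ _ B uv.1 uv.2 v_neq0.
  split; [apply: leq_trans le_t _ | apply: leq_trans le_s _];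
    by rewrite leq_mul2l leq_mul ?orbT ?leq_maxr.
have le_QAn : #|QA| <= n := leq_maxl _ _.
have n_gt0 : 0 < n := leq_trans QA_gt0 le_QAn.
(* A common unit: every quantity is compared with [U] or [c * U], which leaves essentially linear
   arithmetic. *)
pose U := K * n ^ 2.
have le_nU : #|QA| <= U.
  apply: leq_trans le_QAn _; rewrite /U expnS expn1 mulnA.
  by rewrite leq_pmull // muln_gt0 n_gt0 andbT; lia.
have le_LU : L <= U.
  rewrite /U /L expnS expn1 mulnC leq_mul2l; apply/orP; right.
  by apply: leq_trans le_QAn _; rewrite leq_pmull.
have le_WU : W <= c * U.
  rewrite /U /W /L leq_mul2l; apply/orP; right.
  by rewrite mulnA [X in _ <= X]mulnC expnS expn1 leq_mul2r leq_mul2l le_QAn !orbT.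
have U_gt0 : 0 < U := leq_trans QA_gt0 le_nU.
pose T := (1100 + 2 * c) * (M * K * n ^ 2).
pose S := (1100 + 2 * c) * U.
have safe_imc2 : safe mt A B S T (start Sigma (imc2 K p_stop eps delta)).
  (* A run with no commands left would be stuck; the false postcondition says that this never
     happens and every execution ends in a return. *)
  apply: (@wp_imc2 _ mt _ _ _ A B _ _ S W M p_stop (erefl _) A_live K_ge2 p01 test_W _
          (fun _ _ => False)) => //.
    by rewrite /S -/L; lia.
  rewrite /T -mulnA -/U -/L.
  (* The 50 units outside the loop are absorbed by [M * (50 * U)], as [M] and [U] are positive. *)
  apply: (@leq_trans (M * (1000 * U + 2 * (c * U)) + M * (50 * U))).
    by rewrite leq_add // ?leq_mul2l; lia.
  by rewrite -mulnDr; lia.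
split=> t c' reach_c'; have [le_t ok le_s] := safe_imc2 _ _ reach_c'; by [].
Qed.
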